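(* For any integer $d>2$, there does not exist a connected graph $G$ satisfying $g(G)=eg(G)=seg(G)=2$ and $meg(G)=d$.
   Context: All graphs are finite, simple, undirected and connected. Let $G$ be such a graph with vertex set $V(G)$ and edge set $E(G)$. - A geodetic set of $G$ is a set $S\subseteq V(G)$ such that every vertex of $G$ lies on some (at least one) shortest path between some pair of distinct vertices of $S$. The geodetic number $g(G)$ is the minimum cardinality of a geodetic set. - An edge-geodetic set of $G$ is a set $S\subseteq V(G)$ such that every edge of $G$ lies on some (at least one) shortest path between some pair of distinct vertices of $S$. The edge-geodetic number $eg(G)$ is the minimum cardinality of an edge-geodetic set. - A strong edge-geodetic set of $G$ is a set $S\subseteq V(G)$ for which one can choose, for each unordered pair of distinct vertices $u,v\in S$, one specific shortest $u$--$v$ path $P_{uv}$, such that every edge of $G$ lies on at least one of the chosen paths. The strong edge-geodetic number $seg(G)$ is the minimum cardinality of a strong edge-geodetic set. - A monitoring edge-geodetic set (MEG-set) of $G$ is a set $S\subseteq V(G)$ such that for every edge $e\in E(G)$ there is a pair of distinct vertices $u,v\in S$ such that $e$ lies on every shortest $u$--$v$ path in $G$. The monitoring edge-geodetic number $meg(G)$ is the minimum cardinality of an MEG-set. *)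

(* Defs.v *)
From mathcomp Require Import all_boot.

Set Implicit Arguments.
Unset Strict Implicit.
Unset Printing Implicit Defensive.

Record sgraph := SGraph {
  vertex :> finType;
  adj : rel vertex;
  adj_sym : symmetric adj;
  adj_irr : irreflexive adj
}.

Definition connected (G : sgraph) : Prop :=
  0 < #|G| /\ forall x y : G, connect (@adj G) x y.

Definition edges (G : sgraph) : {set {set G}} :=
  [set [set x; y] | x in G, y in G & adj x y].

(* A path is the sequence of all its vertices, both ends included. *)
Definition is_path (G : sgraph) (u v : G) (s : seq G) : bool :=
  if s is x :: p
  then [&& x == u, path (@adj G) x p, last x p == v & uniq (x :: p)]
  else false.

Definition shortest_path (G : sgraph) (u v : G) (s : seq G) : Prop :=
  is_path u v s /\ forall t : seq G, is_path u v t -> size s <= size t.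

Definition path_edges (G : sgraph) (s : seq G) : seq {set G} :=
  if s is x :: p then pairmap (fun a b : G => [set a; b]) x p else [::].

Definition geodetic (G : sgraph) (S : {set G}) : Prop :=
  forall x : G, exists u v : G, exists s : seq G,
    [/\ u \in S, v \in S, u != v, shortest_path u v s & x \in s].

Definition edge_geodetic (G : sgraph) (S : {set G}) : Prop :=
  forall e : {set G}, e \in edges G -> exists u v : G, exists s : seq G,
    [/\ u \in S, v \in S, u != v, shortest_path u v s & e \in path_edges s].

(* The paths are indexed by ordered pairs; the condition on [rev] makes
   [P u v] and [P v u] the same undirected path, so that there is a single
   choice for each unordered pair. *)
Definition strong_edge_geodetic (G : sgraph) (S : {set G}) : Prop :=
  exists P : G -> G -> seq G,
    (forall u v : G, u \in S -> v \in S -> u != v ->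
       shortest_path u v (P u v) /\ P v u = rev (P u v)) /\
    (forall e : {set G}, e \in edges G -> exists u v : G,
       [/\ u \in S, v \in S, u != v & e \in path_edges (P u v)]).

Definition monitoring_edge_geodetic (G : sgraph) (S : {set G}) : Prop :=
  forall e : {set G}, e \in edges G -> exists u v : G,
    [/\ u \in S, v \in S, u != v &
        forall s : seq G, shortest_path u v s -> e \in path_edges s].

(* A relation rather than a function, because a set with the property need not
   exist: the one-vertex graph has no geodetic set. *)
Definition min_card (T : finType) (Q : {set T} -> Prop) (k : nat) : Prop :=
  (exists2 S : {set T}, Q S & #|S| = k) /\
  (forall S : {set T}, Q S -> k <= #|S|).

Definition geodetic_number (G : sgraph) (k : nat) : Prop :=
  min_card (@geodetic G) k.

Definition edge_geodetic_number (G : sgraph) (k : nat) : Prop :=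
  min_card (@edge_geodetic G) k.

Definition strong_edge_geodetic_number (G : sgraph) (k : nat) : Prop :=
  min_card (@strong_edge_geodetic G) k.

Definition monitoring_edge_geodetic_number (G : sgraph) (k : nat) : Prop :=
  min_card (@monitoring_edge_geodetic G) k.

(* Main.v *)
Require Import Defs.
From mathcomp Require Import all_boot.

(** The equality $seg(G) = 2$ forces $meg(G) \le 2$.  A strong edge-geodetic set $\{a, b\}$
    offers a single path, one shortest $a$--$b$ path $P$, and $P$ must cover
    every edge of $G$.  So $G$ has no more edges than $P$.  Any other shortest
    $a$--$b$ path has the same length as $P$ and never repeats an edge, hence
    it also uses every edge of $G$.  Thus every edge lies on every shortest
    $a$--$b$ path, and $\{a, b\}$ is itself an MEG-set
    ([strong_edge_geodetic2_monitoring]).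

    The counting step needs that the edge list of a path is duplicate-free
    ([uniq_path_edges]) and consists of edges of $G$ ([path_edges_sub]), and
    that the two orientations of $P$ cover the same edges
    ([path_edges_rev]). *)

Lemma path_edgesP (G : sgraph) (s : seq G) (e : {set G}) :
  e \in path_edges s <->
  exists s1 s2 x y, s = s1 ++ [:: x, y & s2] /\ e = [set x; y].
Proof.
split.
  elim: s => [|a [|b p] IHp] //; rewrite inE => /orP[/eqP-> | /IHp].
    by exists [::], p, a, b.
  by case=> s1 [s2 [x [y [-> ->]]]]; exists (a :: s1), s2, x, y.
case=> s1 [s2 [x [y [-> ->]]]].
elim: s1 => [|a s1 IHs1]; first by rewrite inE eqxx.
by case: s1 IHs1 => [|b s1] IHs1; rewrite inE IHs1 orbT.
Qed.

Lemma path_edges_rev (G : sgraph) (s : seq G) (e : {set G}) :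
  e \in path_edges (rev s) -> e \in path_edges s.
Proof.
case/path_edgesP=> s1 [s2 [x [y [def_s ->]]]]; apply/path_edgesP.
exists (rev s2), (rev s1), y, x; split; last exact: setUC.
by rewrite -[s]revK def_s rev_cat !rev_cons -!cats1 -!catA.
Qed.

Lemma size_path_edges (G : sgraph) (s : seq G) :
  size (path_edges s) = (size s).-1.
Proof. by case: s => //= x p; rewrite size_pairmap. Qed.

(** The first edge contains the first vertex, which no later edge can meet
    since the vertices are distinct. *)
Lemma uniq_path_edges (G : sgraph) (s : seq G) :
  uniq s -> uniq (path_edges s).
Proof.
elim: s => [|a [|b p] IHp] //= /andP[a_notin uniq_p].
apply/andP; split; last exact: IHp.
apply/negP; rewrite -[pairmap _ _ _]/(path_edges (b :: p)).
case/path_edgesP=> s1 [s2 [x [y [def_p def_e]]]].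
have: a \in [set x; y] by rewrite -def_e set21.
apply/negP; apply: contra a_notin; rewrite def_p mem_cat !inE.
by case/orP=> ->; rewrite ?orbT.
Qed.

Lemma path_edges_sub (G : sgraph) (u v : G) (s : seq G) :
  is_path u v s -> {subset path_edges s <= edges G}.
Proof.
case: s => // x p /and4P[_ path_p _ _] e.
elim: p x path_p => [|y p IHp] x //= /andP[adj_xy path_p].
rewrite inE => /orP[/eqP-> | /(IHp y path_p)] //.
by apply/imset2P; exists x y; rewrite ?inE.
Qed.

(** All edges of the graph lie on the single chosen geodesic, and any other
    geodesic between the two vertices has just enough edges to be all of
    them. *)
Lemma strong_edge_geodetic2_monitoring (G : sgraph) (S : {set G}) :
  #|S| = 2 -> strong_edge_geodetic S -> monitoring_edge_geodetic S.
Proof.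
move/eqP/cards2P=> [a [b [a_neq_b def_S]]] [P [geoP coverP]] e e_edge.
have aS : a \in S by rewrite def_S set21.
have bS : b \in S by rewrite def_S set22.
have [[pathP minP] revP] := geoP a b aS bS a_neq_b.
have edgesP f : f \in edges G -> f \in path_edges (P a b).
  case/coverP=> u [v [uS vS u_neq_v]]; move: uS vS u_neq_v.
  rewrite def_S !inE => /orP[]/eqP-> /orP[]/eqP->; rewrite ?eqxx // => _.
  (* The covering path may be given as the one from b to a. *)
  by rewrite revP; apply: path_edges_rev.
exists a, b; split=> // s [path_s min_s].
have uniq_s : uniq (path_edges s).
  by apply: uniq_path_edges; case: s path_s {min_s} => // x p /and4P[].
have s_sub : {subset path_edges s <= path_edges (P a b)}.
  by move=> f /(path_edges_sub _ _ _ _ path_s)/edgesP.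
have le_size : size (path_edges (P a b)) <= size (path_edges s).
  by rewrite !size_path_edges -!subn1 leq_sub2r // minP.
have [_ ->] := uniq_min_size uniq_s s_sub le_size.
exact: edgesP.
Qed.

Theorem theorem6 (d : nat) (hd : 2 < d) :
  ~ exists G : sgraph,
      [/\ connected G,
          geodetic_number G 2,
          edge_geodetic_number G 2,
          strong_edge_geodetic_number G 2
        & monitoring_edge_geodetic_number G d].
Proof.
case=> G [_ _ _ [[S segS cardS] _] [_ min_meg]].
have := min_meg S (strong_edge_geodetic2_monitoring _ _ cardS segS).
by rewrite cardS leqNgt hd.
Qed.
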